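(* Fix $f\in\mathcal D$ and $\nu_*\in M_+(E^\Delta)$ with $f(\nu_* )=\max_{\nu\in M_+(E^\Delta)}f(\nu)$. Let $A$ be the generator of a strongly continuous positive group on $C_\Delta(E)$, and assume the domain of $A$ contains both $D$ and $A(D)$. Then \[\langle A^2(\partial f(\nu_* )),\mu\rangle+\langle (A\otimes A)(\partial^2f(\nu_* )),\mu^2\rangle\le 0\] for every $\mu\in M_+(E^\Delta)$ with $\mu\le\nu_*$ and $\operatorname{supp}(\mu)\subseteq\operatorname{supp}(\nu_* )$.
   Context: $E$ is a locally compact Polish space, $E^\Delta=E\cup\{\Delta\}$ its one-point compactification ($E^\Delta=E$ if $E$ compact). $M_+(E^\Delta)$ denotes finite non-negative Borel measures on $E^\Delta$; $\mu\le\nu$ means $\nu-\mu\in M_+(E^\Delta)$. $C_\Delta(E^k)=\{f|_{E^k}: f\in C((E^\Delta)^k)\}$ with sup norm; $\widehat C_\Delta(E^k)$ the symmetric ones; $g\otimes h$ denotes the symmetrized tensor product $(g\otimes h)(x_1,\dots,x_{k+\ell})=\frac1{(k+\ell)!}\sum_{\sigma}g(x_{\sigma(1)},\dots,x_{\sigma(k)})h(x_{\sigma(k+1)},\dots,x_{\sigma(k+\ell)})$. $D\subseteq C_\Delta(E)$ is a dense linear subspace containing $1$, $D\otimes D=\operatorname{span}\{g\otimes g:g\in D\}$. For $g\in\widehat C_\Delta(E^k)$, $\langle g,\nu^k\rangle=\int g\,d\nu(x_1)\cdots d\nu(x_k)$. $\mathcal D$ is the linear span of all maps $\nu\mapsto\phi(\langle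 g_1,\nu\rangle,\dots,\langle g_m,\nu\rangle)$ with $g_i\in D$, $m\in\mathbb N_0$, and $\phi$ either a polynomial on $\mathbb R^m$ or in $C_0^\infty(\mathbb R^m)$; these are regarded as functions on $M(E^\Delta)$ by the same formula. $\partial_xf(\nu)=\lim_{\varepsilon\to0}(f(\nu+\varepsilon\delta_x)-f(\nu))/\varepsilon$ for $x\in E^\Delta$, $\partial f(\nu)=(x\mapsto\partial_xf(\nu))\in D$, $\partial^2f(\nu)=((x,y)\mapsto\partial_x\partial_yf(\nu))\in D\otimes D$. A group $(T_t)_{t\in\mathbb R}$ on $C_\Delta(E)$ is positive if $T_tg\ge0$ for all $0\le g\in C_\Delta(E)$. For a linear $A:D\to C_\Delta(E)$, $A\otimes A$ is the linear operator on $D\otimes D$ determined by $(A\otimes A)(g\otimes g)=(Ag)\otimes(Ag)$. *)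

(* Defs.v *)
From Stdlib Require List.
From HB Require Import structures.
From mathcomp Require Import all_boot all_order all_algebra.
From mathcomp Require Import all_classical all_reals all_analysis.
Set Implicit Arguments. Unset Strict Implicit. Unset Printing Implicit Defensive.
Import Order.TTheory GRing.Theory Num.Theory.
Import numFieldNormedType.Exports.
Local Open Scope classical_set_scope.
Local Open Scope ring_scope.

(* Convention: the compact space E^Delta is modelled by a compact Hausdorff
   (pseudo)metric space K; C_Delta(E) is identified with C(K). *)

Definition borelK (R : realType) (K : pseudoPMetricType R) :=
  g_sigma_algebraType (@open K).

Inductive poly_fun (R : realType) (m : nat) : ('rV[R]_m -> R) -> Prop :=
| poly_cst (c : R) : poly_fun (fun _ => c)
| poly_coord (i : 'I_m) : poly_fun (fun v => v ord0 i)
| poly_add p q : poly_fun p -> poly_fun q -> poly_fun (fun v => p v + q v)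
| poly_mul p q : poly_fun p -> poly_fun q -> poly_fun (fun v => p v * q v).

Definition partial (R : realType) (m : nat) (i : 'I_m) (phi : 'rV[R]_m -> R)
  : 'rV[R]_m -> R := fun v => 'D_(delta_mx ord0 i) phi v.

CoInductive smooth (R : realType) (m : nat) (phi : 'rV[R]_m -> R) : Prop :=
| smooth_intro : (forall v, differentiable phi v) ->
    (forall i, smooth (partial i phi)) -> smooth phi.

Definition Cc_infty (R : realType) (m : nat) (phi : 'rV[R]_m -> R) : Prop :=
  smooth phi /\ exists M : R, forall v, M < `|v| -> phi v = 0.

(* one generating map  nu |-> phi(<g_1,nu>, ..., <g_m,nu>) *)
Record cyl_term (R : realType) (K : Type) := CylTerm {
  ct_m : nat;
  ct_phi : 'rV[R]_ct_m -> R;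
  ct_g : 'I_ct_m -> K -> R }.
Arguments ct_m {R K} c.
Arguments ct_phi {R K} c _.
Arguments ct_g {R K} c _ _.

(* an element of \mathcal D, given as a finite linear combination *)
Definition cyl_formula (R : realType) (K : Type) := seq (R * cyl_term R K).

Definition in_calD (R : realType) (K : Type) (D : set (K -> R))
  (F : cyl_formula R K) : Prop :=
  forall p, Stdlib.Lists.List.In p F ->
    (forall i, D (ct_g p.2 i)) /\
    (poly_fun (ct_phi p.2) \/ Cc_infty (ct_phi p.2)).

(* value of the formula at a (signed) measure, given through its pairing
   functional  g |-> <g, nu> *)
Definition cyl_eval (R : realType) (K : Type) (F : cyl_formula R K)
  (ell : (K -> R) -> R) : R :=
  \sum_(p <- F) p.1 * ct_phi p.2 (\row_(i < ct_m p.2) ell (ct_g p.2 i)).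

Section Meas.
Variables (R : realType) (K : pseudoPMetricType R).

Definition pair (nu : {measure set (borelK K) -> \bar R}) (g : K -> R) : R :=
  Rintegral nu setT g.

Definition pair2 (nu : {measure set (borelK K) -> \bar R}) (h : K -> K -> R)
  : R := Rintegral nu setT (fun y => Rintegral nu setT (fun x => h x y)).

Definition cyl_val (F : cyl_formula R K)
  (nu : {measure set (borelK K) -> \bar R}) : R :=
  cyl_eval F (pair nu).

(* d_x f(nu) = lim_{e -> 0} (f(nu + e delta_x) - f(nu)) / e *)
Definition dcyl (F : cyl_formula R K)
  (nu : {measure set (borelK K) -> \bar R}) : K -> R :=
  fun x => derive1 (fun e : R => cyl_eval F (fun g => pair nu g + e * g x)) 0.

Definition d2cyl (F : cyl_formula R K)
  (nu : {measure set (borelK K) -> \bar R}) : K -> K -> R :=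
  fun x y => derive1 (fun e : R =>
    derive1 (fun h : R =>
      cyl_eval F (fun g => pair nu g + e * g x + h * g y)) 0) 0.

Definition msupp (nu : {measure set (borelK K) -> \bar R}) : set K :=
  [set x | forall U : set K, open U -> U x -> (0 < nu U)%E].

Definition dense_subspace_one (D : set (K -> R)) : Prop :=
  [/\ (forall g : K -> R, D g -> continuous g),
      (forall g h : K -> R, D g -> D h -> D (fun x => g x + h x)),
      (forall (a : R) (g : K -> R), D g -> D (fun x => a * g x)),
      D (fun _ => 1) &
      (forall g : K -> R, continuous g -> forall e : R, 0 < e ->
         exists2 h, D h & forall x, `|g x - h x| < e)].

Definition pos_C0_group (T : R -> (K -> R) -> (K -> R)) : Prop :=
  [/\ (forall t (g : K -> R), continuous g -> continuous (T t g)),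
      (forall t (a b : R) (g h : K -> R), continuous g -> continuous h ->
         T t (fun x => a * g x + b * h x) = (fun x => a * T t g x + b * T t h x)),
      (forall g : K -> R, continuous g -> T 0 g = g) &
   [/\
      (forall s t (g : K -> R), continuous g -> T (s + t) g = T s (T t g)),
      (forall g : K -> R, continuous g -> forall t0 e, 0 < e -> exists2 d, 0 < d &
         forall t, `|t - t0| < d -> forall x, `|T t g x - T t0 g x| < e) &
      (forall t (g : K -> R), continuous g -> (forall x, 0 <= g x) -> forall x, 0 <= T t g x)]].

Definition gen_quot_to (T : R -> (K -> R) -> (K -> R)) (g h : K -> R) : Prop :=
  forall e, 0 < e -> exists2 d, 0 < d &
    forall t, 0 < t < d -> forall x, `|(T t g x - g x) / t - h x| < e.

Definition gen_dom (T : R -> (K -> R) -> (K -> R)) (g : K -> R) : Prop :=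
  continuous g /\ exists2 h, continuous h & gen_quot_to T g h.

Definition is_generator (T : R -> (K -> R) -> (K -> R))
  (A : (K -> R) -> (K -> R)) : Prop :=
  forall g : K -> R, gen_dom T g -> continuous (A g) /\ gen_quot_to T g (A g).

End Meas.

(* Main.v *)
Require Import Defs.
From HB Require Import structures.
From mathcomp Require Import all_boot all_order all_algebra.
From mathcomp Require Import all_classical all_reals all_analysis.
From mathcomp Require Import finmap measurable_realfun ring lra.
Import Order.TTheory GRing.Theory Num.Theory.
Import numFieldNormedType.Exports.
Local Open Scope classical_set_scope.
Local Open Scope ring_scope.

(* Let nu0 be the maximizer of f.  For each real t the functional
     L_t g = <g, nu0> - <g, mu> + <T_t g, mu>
   is positive on C(K), because mu <= nu0 and T_t is positive.  Hence L_t is a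
   limit, on the finitely many test functions occurring in f, of finite measures,
   and f(L_t) <= f(nu0) = f(L_0): the function t |-> f(L_t) has a global maximum
   at t = 0.  It is defined on both sides of 0 because T is a group, and it is
   differentiable with a derivative that is again differentiable at 0, so its
   second derivative there is <= 0.  By the chain rule that second derivative is
   <A^2 (d f(nu0)), mu> + <(A (x) A)(d^2 f(nu0)), mu^2>. *)

(** * Positive functionals and pairing with measures *)

(** Both conditions concern continuous functions only, the ones on which [pos_C0_group] constrains
    [T t]. *)
Definition positive_functional {R : realType} {K : pseudoPMetricType R}
    (L : (K -> R) -> R) : Prop :=
  (forall a b (g h : K -> R), continuous g -> continuous h ->
     L (fun x => a * g x + b * h x) = a * L g + b * L h) /\
  (forall g : K -> R, continuous g -> (forall x, 0 <= g x) -> 0 <= L g).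

Section FiniteMsum.
Context d (T : measurableType d) (R : realType).
Variables (m : nat -> {finite_measure set T -> \bar R}) (n : nat).

(** Makes finite sums of point masses admissible competitors in the maximality hypothesis, which
    ranges over finite measures. *)
Let fin_num_msum : fin_num_fun (msum m n).
Proof.
move=> A mA; rewrite /msum.
apply: (big_ind (fun x : \bar R => x \is a fin_num)) => [//|x y fx fy|i _].
  by rewrite fin_numD fx.
exact: fin_num_measure.
Qed.

HB.instance Definition _ :=
  Measure_isFinite.Build _ _ _ (msum m n) fin_num_msum.

End FiniteMsum.

Section ContinuousFunctions.
Context {R : realType} {K : pseudoPMetricType R}.
Implicit Types (f g h : K -> R).

Lemma continuous_lin a b g h : continuous g -> continuous h ->
  continuous (fun x => a * g x + b * h x).
Proof.
move=> cg ch x; apply: cvgD; apply: cvgM; first exact: cvg_cst.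
- exact: cg.
- exact: cvg_cst.
- exact: ch.
Qed.

Lemma continuous_bounded g : compact [set: K] -> continuous g ->
  exists2 M, 0 < M & forall x, `|g x| <= M.
Proof.
move=> cK cg.
have /compact_bounded[M [_ HM]] : compact (g @` [set: K]).
  by apply: continuous_compact => //; exact: continuous_subspaceT.
exists (`|M| + 1) => [|x]; first by rewrite ltr_wpDl.
apply: (HM (`|M| + 1)); last by exists x.
by rewrite (le_lt_trans (ler_norm _))// ltrDl.
Qed.

Lemma continuous_measurable g : continuous g ->
  measurable_fun [set: borelK K] (g : borelK K -> R).
Proof.
move=> /continuousP cg; apply: (measurability _ (RGenOpens.measurableE R)).
move=> _ [_ [a [b ->] <-]].
by rewrite setTI; apply: sub_sigma_algebra; exact/cg/interval_open.
Qed.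

Section PositiveFunctional.
Context {L : (K -> R) -> R} (HL : positive_functional L).

Lemma pfun_lin a b g h : continuous g -> continuous h ->
  L (fun x => a * g x + b * h x) = a * L g + b * L h.
Proof. by case: HL => + _; exact. Qed.

Lemma pfun_ge0 g : continuous g -> (forall x, 0 <= g x) -> 0 <= L g.
Proof. by case: HL => _; exact. Qed.

Let c1 : continuous (fun _ : K => 1 : R).
Proof. by move=> x; exact: cvg_cst. Qed.

Lemma pfunB g h : continuous g -> continuous h ->
  L (fun x => g x - h x) = L g - L h.
Proof.
move=> cg ch; transitivity (L (fun x => 1 * g x + (-1) * h x)).
  by congr L; apply/funext => x; rewrite mul1r mulN1r.
by rewrite pfun_lin// mul1r mulN1r.
Qed.

Lemma pfunZ a g : continuous g -> L (fun x => a * g x) = a * L g.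
Proof.
move=> cg; transitivity (L (fun x => a * g x + 0 * g x)).
  by congr L; apply/funext => x; rewrite mul0r addr0.
by rewrite pfun_lin// mul0r addr0.
Qed.

(** Positivity applied to [e + g] and [e - g]. The factor [L (fun=> 1)] is the total mass of [L] and
    reappears in all later estimates. *)
Lemma pfun_le_bound g e : continuous g ->
  (forall x, `|g x| <= e) -> `|L g| <= e * L (fun=> 1).
Proof.
move=> cg ge; rewrite ler_norml -mulNr -subr_ge0 -(subr_ge0 (L g)).
have H a b : (forall x, 0 <= a * 1 + b * g x) -> 0 <= a * L (fun=> 1) + b * L g.
  by move=> Hab; rewrite -pfun_lin//; apply: pfun_ge0 => //; exact: continuous_lin.
apply/andP; split.
  rewrite (_ : _ - _ = e * L (fun=> 1) + 1 * L g); last by ring.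
  by apply: H => x; move: (ge x); rewrite ler_norml => /andP[]; lra.
rewrite (_ : _ - _ = e * L (fun=> 1) + -1 * L g); last by ring.
by apply: H => x; move: (ge x); rewrite ler_norml => /andP[]; lra.
Qed.

Lemma pfun_sum n (a : 'I_n -> R) (f : 'I_n -> K -> R) :
  (forall i, continuous (f i)) ->
  continuous (fun x => \sum_(i < n) a i * f i x) /\
  L (fun x => \sum_(i < n) a i * f i x) = \sum_(i < n) a i * L (f i).
Proof.
elim: n a f => [|n IH] a f cf.
  under eq_fun do rewrite big_ord0.
  split; first by move=> x; exact: cvg_cst.
  rewrite big_ord0; transitivity (L (fun x => 0 * 1 + 0 * 1)).
    by congr L; apply/funext => x; lra.
  by rewrite (pfun_lin 0 0 _ _ c1 c1); lra.
have [cS LS] := IH (fun i => a (lift ord0 i)) (fun i => f (lift ord0 i))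
  (fun i => cf _).
have E : (fun x => \sum_(i < n.+1) a i * f i x) = (fun x => a ord0 * f ord0 x +
   1 * \sum_(i < n) a (lift ord0 i) * f (lift ord0 i) x).
  by apply/funext => x; rewrite big_ord_recl mul1r.
rewrite E; split; first exact: continuous_lin.
by rewrite pfun_lin// LS mul1r big_ord_recl.
Qed.

End PositiveFunctional.

Section Pairing.
Hypothesis cK : compact [set: K].
Variable nu : {finite_measure set (borelK K) -> \bar R}.

Lemma continuous_integrable g : continuous g ->
  nu.-integrable [set: borelK K] (EFin \o (g : borelK K -> R)).
Proof.
move=> cg; apply: measurable_bounded_integrable => //.
- by rewrite ltey_eq fin_num_measure.
- exact: continuous_measurable.
have [M M0 gM] := continuous_bounded g cK cg.
exists M; split=> [|N MN x _]; first exact: num_real.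
exact: le_trans (gM x) (ltW MN).
Qed.

Lemma pair_positive : positive_functional (pair nu).
Proof.
split=> [a b g h cg ch|g cg g0]; last by apply: Rintegral_ge0 => x _; exact: g0.
have Z c f : continuous f -> continuous (fun x => c * f x).
  by move=> cf x; apply: cvgM; [exact: cvg_cst|exact: cf].
rewrite /pair RintegralD//; [|by apply: continuous_integrable; exact: Z..].
by rewrite !RintegralZl//; exact: continuous_integrable.
Qed.

End Pairing.

Lemma pair_le (cK : compact [set: K])
    (mu nu : {finite_measure set (borelK K) -> \bar R}) g :
  (forall S : set (borelK K), measurable S -> (mu S <= nu S)%E) ->
  continuous g -> (forall x, 0 <= g x) -> pair mu g <= pair nu g.
Proof.
move=> munu cg g0; rewrite /pair /Rintegral fine_le//.
- by apply: integrable_fin_num => //; exact: continuous_integrable.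
- by apply: integrable_fin_num => //; exact: continuous_integrable.
- apply: ge0_le_measure_integral => //.
  by apply/measurable_EFinP; exact: continuous_measurable.
Qed.

Lemma atomic_measure (cK : compact [set: K]) n (a : 'I_n -> R)
    (y : 'I_n -> K) : (forall i, 0 <= a i) ->
  exists nu : {finite_measure set (borelK K) -> \bar R},
    forall g, continuous g -> pair nu g = \sum_(i < n) a i * g (y i).
Proof.
move=> a0.
pose a' i : {nonneg R} := NngNum (a0 i).
(* [msum] takes a sequence over [nat]; indices outside ['I_n] receive the zero measure. *)
pose ms (k : nat) : {finite_measure set (borelK K) -> \bar R} :=
  if insub k is Some i then mscale (a' i) (dirac (y i : borelK K)) else mzero.
exists (msum ms n) => g cg.
have ge0 h : continuous h -> (forall x, 0 <= h x) ->
    pair (msum ms n) h = \sum_(i < n) a i * h (y i).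
  move=> ch h0.
  have mh : measurable_fun [set: borelK K] (EFin \o (h : borelK K -> R)).
    by apply/measurable_EFinP; exact: continuous_measurable.
  have hh x : [set: borelK K] x -> (0 <= (EFin \o (h : borelK K -> R)) x)%E.
    by move=> _; rewrite lee_fin; exact: h0.
  rewrite /pair /Rintegral ge0_integral_measure_sum//.
  rewrite (eq_bigr (fun i : 'I_n => (a i * h (y i))%:E)) => [|i _].
    by rewrite sumEFin.
  rewrite /ms valK ge0_integral_mscale//.
  by rewrite integral_dirac// diracT mul1e.
(* A general [g] is the difference of the nonnegative functions [g + M] and [M]. *)
have [M M0 gM] := continuous_bounded g cK cg.
have c1 : continuous (fun _ : K => 1 : R) by move=> x; exact: cvg_cst.
have -> : pair (msum ms n) g = pair (msum ms n) (fun x => 1 * g x + M * 1)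
    - M * pair (msum ms n) (fun=> 1).
  by rewrite (pfun_lin (pair_positive cK _))//; lra.
rewrite ge0; [|exact: continuous_lin| ]; last first.
  by move=> x; move: (gM x); rewrite ler_norml => /andP[]; lra.
rewrite ge0//; rewrite mulr_sumr -sumrB; apply: eq_bigr => i _; ring.
Qed.

End ContinuousFunctions.

(** * Differential calculus *)

Lemma is_derive_comp_row {R : realType} m (phi : 'rV[R]_m -> R)
    (v : 'I_m -> R -> R) (dv : 'I_m -> R) (t : R) :
  differentiable phi (\row_i v i t) ->
  (forall i, is_derive t 1 (v i) (dv i)) ->
  is_derive t 1 (fun s => phi (\row_i v i s))
    (\sum_i partial i phi (\row_i v i t) * dv i).
Proof.
move=> dphi Hv; set w := fun s : R => (\row_i v i s : 'rV[R]_m).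
have wE i j : (fun s => w s i j) = v j by apply/funext => s; rewrite mxE.
have dw : derivable w t 1.
  by apply/derivable_mxP => i j; rewrite wE; exact: (@ex_derive _ _ _ _ _ _ _ (Hv j)).
have Dw : differentiable w t by apply/derivable1_diffP.
have dpw : differentiable (phi \o w) t by exact: differentiable_comp.
apply: DeriveDef; first exact/derivable1_diffP.
rewrite (_ : (fun s => phi _) = phi \o w)// deriveE// diff_comp//=.
have -> : 'd w t 1 = 'D_1 w t by rewrite deriveE.
rewrite derive_mx//.
(* Expanding the velocity in the canonical basis turns the differential into partial derivatives. *)
transitivity ('d phi (w t) (\sum_i dv i *: delta_mx ord0 i)).
  congr ('d phi (w t) _); apply/matrixP => i j; rewrite !mxE wE (ord1 i).
  rewrite (@derive_val _ _ _ _ _ _ _ (Hv j)) summxE (bigD1 j)//= !mxE !eqxx mulr1.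
  rewrite big1 ?addr0// => k kj; rewrite !mxE eqxx /= [j == k]eq_sym.
  by rewrite (negbTE kj) mulr0.
rewrite linear_sum; apply: eq_bigr => i _.
by rewrite linearZ /= mulrC /partial deriveE.
Qed.

(** The coinduction invariant for [poly_smooth]: each unfolding of [smooth] asks for
    differentiability and for partial derivatives of the same kind. *)
Lemma partial_poly_fun {R : realType} m (p : 'rV[R]_m -> R) : poly_fun p ->
  (forall v, differentiable p v) /\ forall i, poly_fun (partial i p).
Proof.
elim=> {p} [c|j|p q _ [dp pp] _ [dq pq]|p q Pp [dp pp] Pq [dq pq]].
- split=> [v|i]; first exact: differentiable_cst.
  have -> : partial i (fun _ : 'rV[R]_m => c) = (fun=> 0).
    by apply/funext => v; exact: derive_cst.
  exact: poly_cst.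
- split=> [v|i]; first exact: differentiable_coord.
  have -> : partial i (fun v : 'rV[R]_m => v ord0 j) =
      (fun=> (delta_mx ord0 i : 'rV[R]_m) ord0 j).
    apply/funext => v.
    have := derive_mx (@derivable_id _ _ v (delta_mx ord0 i : 'rV[R]_m)).
    by rewrite derive_id => /matrixP /(_ ord0 j); rewrite [in RHS]mxE.
  exact: poly_cst.
- split=> [v|i]; first exact: differentiableD.
  have -> : partial i (fun v => p v + q v) =
      (fun v => partial i p v + partial i q v).
    by apply/funext => v; apply: deriveD; exact: diff_derivable.
  exact: poly_add.
- split=> [v|i]; first exact: differentiableM.
  have -> : partial i (fun v => p v * q v) =
      (fun v => p v * partial i q v + q v * partial i p v).
    by apply/funext => v; apply: deriveM; exact: diff_derivable.
  by apply: poly_add; exact: poly_mul.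
Qed.

CoFixpoint poly_smooth {R : realType} m (p : 'rV[R]_m -> R) (Pp : poly_fun p) :
    smooth p :=
  smooth_intro (proj1 (partial_poly_fun _ _ Pp))
    (fun i => poly_smooth _ _ (proj2 (partial_poly_fun _ _ Pp) i)).

Lemma is_derive_bigsum {R : realType} (I : Type) (r : seq I) (f : I -> R -> R)
    (df : I -> R) (t : R) :
  (forall i, List.In i r -> is_derive t 1 (f i) (df i)) ->
  is_derive t 1 (fun s => \sum_(i <- r) f i s) (\sum_(i <- r) df i).
Proof.
elim: r => [|i r IH] H.
  rewrite big_nil; under eq_fun do rewrite big_nil.
  exact: is_derive_cst.
rewrite big_cons; under eq_fun do rewrite big_cons.
apply: is_deriveD; first by apply: H; left.
by apply: IH => j jr; apply: H; right.
Qed.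

(** If [c] were positive, then [f1 0 = 0] would force [f1] to be positive just to the right of 0,
    and the mean value theorem would give a value of [f] above [f 0]. *)
Lemma max_second_derivative_le0 {R : realType} (f f1 : R -> R) (c : R) :
  (forall t, f t <= f 0) -> (forall t : R, is_derive t 1 f (f1 t)) ->
  is_derive (0 : R) 1 f1 c -> c <= 0.
Proof.
move=> fmax df df1; rewrite leNgt; apply/negP => c0.
have f10 : f1 0 = 0.
  have D0 : is_derive (0 : R) 1 f 0.
    apply: (@derive1_at_max _ f (-1) 1) => //; rewrite ?in_itv/=; try lra.
  rewrite -(@derive_val _ _ _ _ _ _ _ (df 0)).
  exact: (@derive_val _ _ _ _ _ _ _ D0).
have cv : (fun h => h^-1 *: (f1 (h *: 1 + 0) - f1 0)) @ 0^' --> c.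
  have := @ex_derive _ _ _ _ _ _ _ df1.
  by have := @derive_val _ _ _ _ _ _ _ df1 => <-.
(* Tolerance [c] is just what makes the difference quotients of [f1] positive; the half radius
   [d / 2] below keeps [xi] inside the neighbourhood. *)
have /cvgrPdist_lt /(_ c c0) [d /= d0 Hd] := cv.
have [||xi xi_in E] := @MVT _ f f1 0 (d / 2) _ (fun x _ => df x).
- by rewrite divr_gt0.
- apply: derivable_within_continuous => x _.
  exact: (@ex_derive _ _ _ _ _ _ _ (df x)).
move: xi_in; rewrite in_itv /= => /andP[xi0 xid].
have : `|c - xi^-1 * (f1 (xi * 1 + 0) - f1 0)| < c.
  apply: Hd; last by rewrite gt_eqF.
  by rewrite /= sub0r normrN gtr0_norm//; lra.
rewrite f10 subr0 mulr1 addr0 ltr_norml => /andP[_ H].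
have f1xi : 0 < f1 xi.
  have : 0 < xi^-1 * f1 xi by lra.
  by rewrite pmulr_rgt0// invr_gt0.
have := fmax (d / 2); rewrite -subr_le0 E leNgt => /negP; apply.
by rewrite mulr_gt0// subr0 divr_gt0.
Qed.

(** * Derivatives of cylinder functions *)

Lemma calD_smooth {R : realType} {K : Type} {D : set (K -> R)}
    {F : cyl_formula R K} {p} :
  in_calD D F -> List.In p F -> smooth (ct_phi p.2).
Proof. by move=> HF /HF[_ [/poly_smooth//|[]]]. Qed.

Section CylinderCalculus.
Context {R : realType} {K : Type} {D : set (K -> R)} {F : cyl_formula R K}.
Hypothesis HF : in_calD D F.
Implicit Types (l q r w : (K -> R) -> R).

Definition cyl_row (c : cyl_term R K) l : 'rV[R]_(ct_m c) :=
  \row_i l (ct_g c i).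

(* [cyl_d1 l q] and [cyl_d2 l q r] are the first and second derivatives at [l],
   in the directions [q] and [r], of the cylinder function seen as a function of
   the pairing functional. *)
Definition cyl_d1 l q : R :=
  \sum_(p <- F) p.1 * \sum_(i < ct_m p.2)
    partial i (ct_phi p.2) (cyl_row p.2 l) * q (ct_g p.2 i).

Definition cyl_d2 l q r : R :=
  \sum_(p <- F) p.1 * \sum_(i < ct_m p.2) (\sum_(j < ct_m p.2)
    partial j (partial i (ct_phi p.2)) (cyl_row p.2 l) * r (ct_g p.2 j))
    * q (ct_g p.2 i).

Section AlongCurve.
Context {l : R -> (K -> R) -> R} {r : (K -> R) -> R} {t : R}.
Hypothesis Hl : forall g, D g -> is_derive t 1 (fun s => l s g) (r g).

Lemma is_derive_cyl_eval :
  is_derive t 1 (fun s => cyl_eval F (l s)) (cyl_d1 (l t) r).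
Proof.
apply: is_derive_bigsum => p pF.
apply: is_deriveZ; apply: is_derive_comp_row; last first.
  by move=> i; apply: Hl; case: (HF p pF).
by case: (calD_smooth HF pF).
Qed.

(** Product rule: the base point [l s] and the direction [q s] both move. Along the orbit curve the
    first summand becomes the A (x) A term and the second the A^2 term. *)
Lemma is_derive_cyl_d1 (q : R -> (K -> R) -> R) w :
  (forall g, D g -> is_derive t 1 (fun s => q s g) (w g)) ->
  is_derive t 1 (fun s => cyl_d1 (l s) (q s))
    (cyl_d2 (l t) (q t) r + cyl_d1 (l t) w).
Proof.
move=> Hq; rewrite -big_split; apply: is_derive_bigsum => p pF /=.
have Dp i : D (ct_g p.2 i) by case: (HF p pF).
rewrite -mulrDr -big_split; apply: is_deriveZ; apply: is_derive_bigsum => i _ /=.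
have dphi : is_derive t 1 (fun s => partial i (ct_phi p.2) (cyl_row p.2 (l s)))
    (\sum_(j < ct_m p.2) partial j (partial i (ct_phi p.2)) (cyl_row p.2 (l t))
      * r (ct_g p.2 j)).
  apply: is_derive_comp_row => [|j]; last exact/Hl/Dp.
  by case: (calD_smooth HF pF) => _ /(_ i) [].
have := @is_deriveM _ _ _ _ _ _ _ _ dphi (Hq _ (Dp i)).
by rewrite addrC /GRing.scale /= [X in _ + X]mulrC.
Qed.

End AlongCurve.

End CylinderCalculus.
Arguments cyl_d1 {R K} F l q.
Arguments cyl_d2 {R K} F l q r.

(** Only the finitely many values on the [ct_g] enter, so a functional may later be replaced by a
    measure close to it on these functions. *)
Lemma cyl_eval_continuous {R : realType} {K : Type} (F : cyl_formula R K)
    (l : (K -> R) -> R) (e : R) :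
  (forall p, List.In p F -> smooth (ct_phi p.2)) -> 0 < e -> exists2 d : R, 0 < d &
  forall l', (forall p i, List.In p F ->
      `|l' (ct_g p.2 i) - l (ct_g p.2 i)| < d) ->
    `|cyl_eval F l' - cyl_eval F l| < e.
Proof.
elim: F e => [|p s IH] e Hs e0.
  by exists 1 => // l' _; rewrite /cyl_eval !big_nil subrr normr0.
have e20 : 0 < e / 2 by rewrite divr_gt0.
have [d d0 Hd] := IH _ (fun q qs => Hs q (or_intror qs)) e20.
have cphi : {for cyl_row p.2 l, continuous (fun v => p.1 * ct_phi p.2 v)}.
  apply: differentiable_continuous; apply: differentiableM => //.
  by case: (Hs p (or_introl erefl)).
move/cvgrPdist_lt : cphi => /(_ _ e20) /nbhs_ballP [d' /= d'0 Hd'].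
exists (Num.min d d'); first by rewrite lt_min d0.
move=> l' Hl'; rewrite /cyl_eval !big_cons.
rewrite (_ : _ - _ = p.1 * ct_phi p.2 (cyl_row p.2 l')
    - p.1 * ct_phi p.2 (cyl_row p.2 l) + (cyl_eval s l' - cyl_eval s l)).
  rewrite (le_lt_trans (ler_normD _ _))// (splitr e) ltrD//.
    rewrite distrC; apply: Hd'; split=> // i j; rewrite !mxE /ball /= distrC.
    by have := Hl' p j (or_introl erefl); rewrite lt_min => /andP[].
  apply: Hd => q i qs.
  by have := Hl' q i (or_intror qs); rewrite lt_min => /andP[].
by rewrite /cyl_eval; ring.
Qed.

Section CylinderDerivatives.
Context {R : realType} {K : pseudoPMetricType R} {D : set (K -> R)}.
Context {F : cyl_formula R K}.
Hypothesis HF : in_calD D F.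
Variable nu : {measure set (borelK K) -> \bar R}.

Let is_derive_line (l q : (K -> R) -> R) (g : K -> R) (t : R) :
  is_derive t 1 (fun s => l g + s * q g) (q g).
Proof.
have := is_deriveD (is_derive_cst (l g) t 1)
  (is_deriveM (is_derive_id t 1) (is_derive_cst (q g) t 1)).
by move=> /is_derive_eq; apply; rewrite /GRing.scale /=; ring.
Qed.

(** Adding [e] times the Dirac mass at [x] moves the pairing functional along a line whose direction
    is evaluation at [x]. *)
Lemma dcylE x : dcyl F nu x = cyl_d1 F (pair nu) (fun g => g x).
Proof.
rewrite /dcyl derive1E.
have /(_ 0) H := @is_derive_cyl_eval _ _ _ _ HF
  (fun e g => pair nu g + e * g x) (fun g => g x).
have /@derive_val -> := H (fun g _ => is_derive_line (pair nu) (fun g => g x) g 0).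
by congr cyl_d1; apply/funext => g; rewrite mul0r addr0.
Qed.

Lemma d2cylE x y :
  d2cyl F nu x y = cyl_d2 F (pair nu) (fun g => g y) (fun g => g x).
Proof.
rewrite /d2cyl.
have -> : (fun e : R => derive1 (fun h : R =>
    cyl_eval F (fun g => pair nu g + e * g x + h * g y)) 0) =
  (fun e => cyl_d1 F (fun g => pair nu g + e * g x) (fun g => g y)).
  apply/funext => e; rewrite derive1E.
  have /(_ 0) H := @is_derive_cyl_eval _ _ _ _ HF
    (fun h g => pair nu g + e * g x + h * g y) (fun g => g y).
  have /@derive_val -> := H (fun g _ =>
    is_derive_line (fun g => pair nu g + e * g x) (fun g => g y) g 0).
  by congr cyl_d1; apply/funext => g; rewrite mul0r addr0.
rewrite derive1E.
(* The direction [fun g => g y] does not move with [e], so its derivative is 0 and only the [cyl_d2]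
   summand survives. *)
have /(_ 0) H := @is_derive_cyl_d1 _ _ _ _ HF
  (fun e g => pair nu g + e * g x) (fun g => g x).
have /@derive_val -> := H (fun g _ => is_derive_line (pair nu) (fun g => g x) g 0)
  (fun _ g => g y) (fun _ => 0) (fun g _ => is_derive_cst _ _ _).
rewrite (_ : (fun g => _ + 0 * _) = pair nu); last first.
  by apply/funext => g; rewrite mul0r addr0.
rewrite [X in _ + X]big1 ?addr0// => p _.
by rewrite big1 ?mulr0// => i _; rewrite mulr0.
Qed.

End CylinderDerivatives.

(** * Approximation of positive functionals *)

Section Approximation.
Context {R : realType} {K : pseudoPMetricType R}.
Hypothesis cK : compact [set: K].

(** The sets [d x y < e] are open in [x] and each contains its centre, so compactness extracts a
    finite cover. Here [d] need not be the metric of [K]; it will be built from test functions. *)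
Lemma finite_net (d : K -> K -> R) (e : R) :
  (forall y, continuous (d ^~ y)) -> (forall x, d x x = 0) -> 0 < e ->
  exists n (y : 'I_n -> K), forall x, exists i, d x (y i) < e.
Proof.
move=> dc d0 e0; move: cK; rewrite compact_cover.
move=> /(_ K setT (fun y => [set x | d x y < e])) [y _|x _|s _ Hs].
- have /continuousP/(_ [set r | r < e]) := dc y.
  by apply; exact: open_lt.
- by exists x => //=; rewrite d0.
exists (size (enum_fset s)), (tnth (in_tuple (enum_fset s))) => x.
have [y /= ys xy] := Hs x I.
have /tnthP [i E] : y \in in_tuple (enum_fset s) by [].
by exists i; rewrite -E.
Qed.

(* Replaces the Riesz representation theorem: with a partition of unity [chi i]
   subordinate to the [d]-balls of radius [e] around a finite net [y i], the
   measure [\sum_i L (chi i) delta_(y i)] is close to [L] on functions that are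
   1-Lipschitz for [d]. *)
Lemma positive_functional_approx (L : (K -> R) -> R) (d : K -> K -> R) (e : R) :
  positive_functional L ->
  (forall y, continuous (d ^~ y)) -> (forall x, d x x = 0) -> 0 < e ->
  exists nu : {finite_measure set (borelK K) -> \bar R},
    forall g, continuous g -> (forall x y, `|g x - g y| <= d x y) ->
      `|pair nu g - L g| <= e * L (fun=> 1).
Proof.
move=> HL dc d0 e0.
have [n [y Hy]] := finite_net d e dc d0 e0.
(* Tent functions, positive exactly on the [d]-balls of the net; hence their sum [S] vanishes
   nowhere and normalizing is legitimate. *)
pose psi i x := Num.max 0 (e - d x (y i)).
pose S x := \sum_(i < n) psi i x.
pose chi i x := psi i x * (S x)^-1.
have psi0 i x : 0 <= psi i x by rewrite le_max lexx.
have S0 x : 0 < S x.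
  have [i Hi] := Hy x; rewrite /S (bigD1 i)//= ltr_pwDl ?sumr_ge0//.
  by rewrite lt_max subr_gt0 Hi orbT.
have psic i : continuous (psi i).
  move=> x; apply: (@continuous_max _ _ (fun=> 0) (fun x => e - d x (y i))).
    exact: cvg_cst.
  by apply: continuousB; [exact: cvg_cst|exact: dc].
have Sc : continuous S.
  by move=> x; apply: cvg_big => [|i _]; [exact: add_continuous|exact: psic].
have chic i : continuous (chi i).
  move=> x; apply: continuousM; first exact: psic.
  by apply: continuousV; [rewrite gt_eqF|exact: Sc].
have chi0 i x : 0 <= chi i x by rewrite mulr_ge0// invr_ge0 ltW.
have chi1 x : \sum_(i < n) chi i x = 1.
  by rewrite /chi -mulr_suml -/(S x) divff// gt_eqF.
have [nu Hnu] := atomic_measure cK n (fun i => L (chi i)) y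
  (fun i => pfun_ge0 HL _ (chic i) (chi0 i)).
exists nu => g cg gd; rewrite Hnu// distrC.
have [cs LS] := pfun_sum HL n (fun i => g (y i)) chi chic.
rewrite (eq_bigr (fun i => g (y i) * L (chi i))) => [|i _]; last exact: mulrC.
rewrite -LS -(pfunB HL)//; apply: (pfun_le_bound HL) => [|x].
  by move=> x; apply: continuousB; [exact: cg|exact: cs].
(* Since the [chi i] sum to 1, the error is an average of differences [g x - g (y i)], with zero
   weight unless [d x (y i) < e]. *)
have -> : g x - \sum_(i < n) g (y i) * chi i x =
    \sum_(i < n) (g x - g (y i)) * chi i x.
  under [RHS]eq_bigr do rewrite mulrBl.
  by rewrite sumrB -mulr_sumr chi1 mulr1.
apply: (le_trans (ler_norm_sum _ _ _)).
rewrite -[leRHS]mulr1 -(chi1 x) mulr_sumr; apply: ler_sum => i _.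
rewrite normrM (ger0_norm (chi0 i x)).
have [de|de] := ltP (d x (y i)) e.
  by apply: ler_wpM2r => //; rewrite (le_trans (gd _ _))// ltW.
suff -> : chi i x = 0 by rewrite !mulr0.
by rewrite /chi /psi max_l ?mul0r// subr_le0.
Qed.

End Approximation.

(** * Orbits of the group and its generator *)

Section Group.
Context {R : realType} {K : pseudoPMetricType R}.
Context {T : R -> (K -> R) -> (K -> R)} (HT : pos_C0_group T).
Implicit Types (g h : K -> R).

Lemma pfun_group t (L : (K -> R) -> R) :
  positive_functional L -> positive_functional (fun g => L (T t g)).
Proof.
case: HT => Tc Tl _ [_ _ Tp] HL; split=> [a b g h cg ch|g cg g0].
  by rewrite Tl// (pfun_lin HL)//; exact: Tc.
by apply: (pfun_ge0 HL); [exact: Tc|exact: Tp].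
Qed.

Section Orbit.
Context {L : (K -> R) -> R} (HL : positive_functional L).

Let c1 : continuous (fun _ : K => 1 : R).
Proof. by move=> x; exact: cvg_cst. Qed.

Lemma orbit_continuous g (t e : R) : continuous g -> 0 < e ->
  exists2 d : R, 0 < d &
    forall s : R, `|s - t| < d -> `|L (T s g) - L (T t g)| < e.
Proof.
move=> cg e0; have L1 : 0 <= L (fun=> 1) by apply: (pfun_ge0 HL).
(* The added 1 keeps the denominator positive when [L] has zero mass. *)
have e'0 : 0 < e / (L (fun=> 1) + 1) by rewrite divr_gt0// ltr_wpDl.
case: (HT) => Tc _ _ [_ Tstr _].
have [d d0 Hd] := Tstr g cg t _ e'0.
exists d => // s sd; rewrite -(pfunB HL); [|exact: Tc..].
apply: (@le_lt_trans _ _ (e / (L (fun=> 1) + 1) * L (fun=> 1))).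
  apply: (pfun_le_bound HL) => [x|x]; last by rewrite ltW// Hd.
  by apply: continuousB; exact: Tc.
by rewrite mulrAC ltr_pdivrMr ?ltr_wpDl// ltr_pM2l// ltrDl.
Qed.

(** By the group law the increment at [t] is the increment at 0 seen through the positive functional
    [L] after [T t]. Hence [d] is chosen before [t], which permits a moving base point in
    [is_derive_orbit]. *)
Lemma orbit_increment g h (e : R) : continuous g -> continuous h ->
  gen_quot_to T g h -> 0 < e ->
  exists2 d : R, 0 < d & forall t s : R, 0 < s -> s < d ->
    `|L (T (t + s) g) - L (T t g) - s * L (T t h)| <= e * s * L (T t (fun=> 1)).
Proof.
move=> cg ch gh e0; have [d d0 Hd] := gh e e0.
exists d => // t s s0 sd; case: (HT) => Tc _ _ [Tsg _ _].
have HLt := pfun_group t L HL.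
have csg : continuous (T s g) by exact: Tc.
rewrite Tsg// -(pfunB HLt)//.
have cB : continuous (fun x => T s g x - g x).
  by move=> x; apply: continuousB; [exact: csg|exact: cg].
have cZ : continuous (fun x => s * h x).
  by move=> x; apply: continuousM; [exact: cvg_cst|exact: ch].
rewrite -(pfunZ HLt s)// -(pfunB HLt)//.
apply: (pfun_le_bound HLt) => [x|x].
  exact: (continuousB (cB x) (cZ x)).
have := Hd s; rewrite s0 sd => /(_ isT x).
have -> : (T s g x - g x) / s - h x = (T s g x - g x - s * h x) / s.
  by field; rewrite gt_eqF.
rewrite normrM normfV (gtr0_norm s0) ltr_pdivrMr//.
exact: ltW.
Qed.

(** [gen_quot_to] is a right-hand limit only. For negative [s] the increment is read forwards from
    [t + s] to [t], and strong continuity replaces [T (t + s) h] by [T t h]. *)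
Lemma is_derive_orbit g h (t : R) : continuous g -> continuous h ->
  gen_quot_to T g h -> is_derive t 1 (fun s => L (T s g)) (L (T t h)).
Proof.
move=> cg ch gh.
suff cv : (fun s => s^-1 *: (((fun s => L (T s g)) \o shift t) (s *: 1)
    - L (T t g))) @ 0^' --> L (T t h).
  by apply: DeriveDef; [exact: cvgP cv|exact: cvg_lim cv].
apply/cvgrPdist_le => e e0.
(* Bounds the mass [L (T r (fun=> 1))] for all base points [r] near [t]. *)
pose C := L (T t (fun=> 1)) + 1.
have C0 : 0 < C by rewrite ltr_wpDl//; apply: (pfun_ge0 (pfun_group t L HL)).
have e2 : 0 < e / 2 by rewrite divr_gt0.
have [d1 d10 H1] := orbit_continuous (fun=> 1) t 1 c1 ltr01.
have [d2 d20 H2] := orbit_continuous h t (e / 2) ch e2.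
have [d3 d30 H3] := orbit_increment g h (e / 2 / C) cg ch gh (divr_gt0 e2 C0).
have H3' (r s : R) : `|r - t| < d1 -> 0 < s -> s < d3 ->
    `|L (T (r + s) g) - L (T r g) - s * L (T r h)| <= e / 2 * s.
  move=> rt s0 sd; apply: (le_trans (H3 r s s0 sd)).
  have /ltr_normlW := H1 r rt; rewrite ltrBlDr addrC -/C => rC.
  rewrite [leRHS](_ : _ = e / 2 / C * s * C); last by field; rewrite gt_eqF.
  by rewrite ler_pM2l ?mulr_gt0 ?invr_gt0//; exact: ltW.
near=> s.
have s0 : s != 0 by near: s; exact: nbhs_dnbhs_neq.
have sd1 : `|s| < d1 by near: s; exact: dnbhs0_lt.
have sd2 : `|s| < d2 by near: s; exact: dnbhs0_lt.
have sd3 : `|s| < d3 by near: s; exact: dnbhs0_lt.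
rewrite /= /shift /= [s *: 1]mulr1 distrC.
have -> : s^-1 *: (L (T (s + t) g) - L (T t g)) - L (T t h) =
    (L (T (s + t) g) - L (T t g) - s * L (T t h)) / s.
  by rewrite /GRing.scale /=; field.
rewrite normrM normfV ler_pdivrMr ?normr_gt0//.
have [sp|sn] := ltP 0 s.
  rewrite [s + t]addrC; move: sd3; rewrite (gtr0_norm sp) => sd3.
  have /H3' /(_ sp sd3) : `|t - t| < d1 by rewrite subrr normr0.
  move=> /le_trans; apply.
  by rewrite ler_pM2r//; lra.
have {}sn : s < 0 by rewrite lt_neqAle s0.
have rt : `|s + t - t| = `|s| by rewrite addrK.
have E : s + t + - s = t by ring.
move: sd1 sd2; rewrite -rt => /H3' H /H2.
have := H (- s); rewrite E => {}H.
move: (sd3); rewrite (ltr0_norm sn) => nsd3.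
have ns0 : 0 < - s by rewrite oppr_gt0.
have {}H := H ns0 nsd3.
move=> Hh.
(* Forward increment of length [- s] from [s + t], plus the correction for the shifted base point;
   each costs at most [e / 2] times the length. *)
have -> : L (T (s + t) g) - L (T t g) - s * L (T t h) =
   - (L (T t g) - L (T (s + t) g) - - s * L (T (s + t) h))
   + s * (L (T (s + t) h) - L (T t h)) by ring.
rewrite (le_trans (ler_normD _ _))// normrN.
apply: (le_trans (lerD H (lexx _))).
rewrite normrM rt (ltr0_norm sn).
have := ltW Hh; rewrite -(ler_pM2l ns0); lra.
Unshelve. all: by end_near. Qed.

End Orbit.
End Group.

(** * Linearity and the maximum principle *)

Section LinearOnSubspace.
Context {R : realType} {K : Type} {D : set (K -> R)} {ell : (K -> R) -> R}.
Hypothesis D1 : D (fun=> 1).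
Hypothesis Dlin : forall a b g h, D g -> D h -> D (fun x => a * g x + b * h x).
Hypothesis ell_lin : forall a b g h, D g -> D h ->
  ell (fun x => a * g x + b * h x) = a * ell g + b * ell h.

(** Since [ell] is linear on [D] only, computing a value needs membership at every stage; the
    conjunction carries both through one induction. *)
Definition has_value (f : K -> R) (v : R) := D f /\ ell f = v.

Lemma has_value_lin a b f g v w : has_value f v -> has_value g w ->
  has_value (fun x => a * f x + b * g x) (a * v + b * w).
Proof. by move=> [Df <-] [Dg <-]; split; [exact: Dlin|exact: ell_lin]. Qed.

Lemma has_value_base f : D f -> has_value f (ell f).
Proof. by []. Qed.

Lemma has_valueZ a f v : has_value f v -> has_value (fun x => a * f x) (a * v).
Proof.
move=> Hf; have := has_value_lin a 0 f f v v Hf Hf.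
by rewrite mul0r addr0; under eq_fun do rewrite mul0r addr0.
Qed.

Lemma has_valueZr a f v : has_value f v -> has_value (fun x => f x * a) (v * a).
Proof.
by move=> /(has_valueZ a); rewrite mulrC; under eq_fun do rewrite mulrC.
Qed.

Lemma has_value_sum (I : Type) (r : seq I) (f : I -> K -> R) (v : I -> R) :
  (forall i, List.In i r -> has_value (f i) (v i)) ->
  has_value (fun x => \sum_(i <- r) f i x) (\sum_(i <- r) v i).
Proof.
elim: r => [|i r IH] H.
  rewrite big_nil; under eq_fun do rewrite big_nil.
  have := has_valueZ 0 _ _ (has_value_base _ D1).
  by rewrite !mul0r.
rewrite big_cons; under eq_fun do rewrite big_cons.
have := has_value_lin 1 1 _ _ _ _ (H i (or_introl erefl))
  (IH (fun j jr => H j (or_intror jr))).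
by rewrite !mul1r; under eq_fun do rewrite !mul1r.
Qed.

Context {F : cyl_formula R K}.
Hypothesis HF : in_calD D F.
Implicit Types (l q r : (K -> R) -> R).

(** [cyl_d1] is a linear combination of the values of its direction on the [ct_g], which lie in [D],
    so [ell] can replace evaluation at [x]. *)
Lemma cyl_d1_lin l :
  has_value (fun x => cyl_d1 F l (fun g => g x)) (cyl_d1 F l ell).
Proof.
apply: has_value_sum => p /HF[Dp _]; apply: has_valueZ.
by apply: has_value_sum => i _; apply: has_valueZ; exact: has_value_base.
Qed.

Lemma cyl_d2_lin_l l r :
  has_value (fun x => cyl_d2 F l (fun g => g x) r) (cyl_d2 F l ell r).
Proof.
apply: has_value_sum => p /HF[Dp _]; apply: has_valueZ.
by apply: has_value_sum => i _; apply: has_valueZ; exact: has_value_base.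
Qed.

Lemma cyl_d2_lin_r l q :
  has_value (fun x => cyl_d2 F l q (fun g => g x)) (cyl_d2 F l q ell).
Proof.
apply: has_value_sum => p /HF[Dp _]; apply: has_valueZ.
apply: has_value_sum => i _; apply: has_valueZr.
by apply: has_value_sum => j _; apply: has_valueZ; exact: has_value_base.
Qed.

(** [ell] is applied to the kernel identity in [x], then in [y]. The right-hand side is thus
    independent of the chosen representation. *)
Lemma cyl_d2_representation l n (c : 'I_n -> R) (gs : 'I_n -> K -> R) :
  (forall i, D (gs i)) ->
  (forall x y, cyl_d2 F l (fun g => g y) (fun g => g x) =
     \sum_(i < n) c i * (gs i x * gs i y)) ->
  cyl_d2 F l ell ell = \sum_(i < n) c i * (ell (gs i) * ell (gs i)).
Proof.
move=> Dgs H.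
have Hy y : cyl_d2 F l (fun g => g y) ell = \sum_(i < n) c i * (ell (gs i) * gs i y).
  rewrite -(cyl_d2_lin_r l (fun g => g y)).2; under eq_fun do rewrite H.
  apply: (has_value_sum _ _ _ _ _).2 => i _; apply: has_valueZ.
  by apply: has_valueZr; exact: has_value_base.
rewrite -(cyl_d2_lin_l l ell).2; under eq_fun do rewrite Hy.
apply: (has_value_sum _ _ _ _ _).2 => i _; apply: has_valueZ.
by apply: has_valueZ; exact: has_value_base.
Qed.

End LinearOnSubspace.

Section Generator.
Context {R : realType} {K : pseudoPMetricType R}.
Context {T : R -> (K -> R) -> (K -> R)} (HT : pos_C0_group T).
Context {A : (K -> R) -> (K -> R)} (HA : is_generator T A).

(** Evaluation at a point is a positive functional, so [A g x] is the derivative of [T s g x] at 0,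
    and derivatives are unique and linear. *)
Lemma generator_lin a b g h : gen_dom T g -> gen_dom T h ->
  gen_dom T (fun x => a * g x + b * h x) ->
  A (fun x => a * g x + b * h x) = (fun x => a * A g x + b * A h x).
Proof.
move=> Dg Dh Dgh; apply/funext => x.
have evx : positive_functional (fun f : K -> R => f x) by split.
have D f : gen_dom T f -> is_derive (0 : R) 1 (fun s => T s f x) (A f x).
  move=> Df; have [cAf qf] := HA f Df.
  have := is_derive_orbit HT evx f (A f) 0 Df.1 cAf qf.
  by case: HT => _ _ T0 _; rewrite (T0 (A f)).
have /@derive_val <- := D _ Dgh.
case: (HT) => _ Tl _ _.
have -> : (fun s => T s (fun y => a * g y + b * h y) x) =
   a *: (fun s => T s g x) + b *: (fun s => T s h x).
  by apply/funext => s; rewrite (Tl s a b g h Dg.1 Dh.1).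
have Hg := D _ Dg; have Hh := D _ Dh.
by have /@derive_val := is_deriveD (is_deriveZ a Hg) (is_deriveZ b Hh).
Qed.

End Generator.

Lemma ler_bigsum_In {R : numDomainType} (I : Type) (r : seq I) (f : I -> R) i :
  (forall j, 0 <= f j) -> List.In i r -> f i <= \sum_(j <- r) f j.
Proof.
move=> f0; elim: r => [//|j r IH] /= [->|/IH H]; rewrite big_cons.
  by rewrite lerDl sumr_ge0.
by rewrite (le_trans H)// lerDr.
Qed.

Section MaximumPrinciple.
Context {R : realType} {K : pseudoPMetricType R}.
Context {D : set (K -> R)} {F : cyl_formula R K}.
Hypotheses (cK : compact [set: K]) (HF : in_calD D F).
Hypothesis Dc : forall g, D g -> continuous g.

(** If [F] exceeded [M] at [L], continuity would make it exceed [M] at a finite measure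
    approximating [L] on the test functions. *)
Lemma cyl_eval_le_max (L : (K -> R) -> R) (M : R) :
  (forall nu : {finite_measure set (borelK K) -> \bar R}, cyl_val F nu <= M) ->
  positive_functional L -> cyl_eval F L <= M.
Proof.
move=> HM HL; rewrite leNgt -subr_gt0; apply/negP => e0.
have [d d0 Hd] := cyl_eval_continuous F L _ (fun p => calD_smooth HF) e0.
(* The pseudo-distance generated by the test functions of [F]: each of them is 1-Lipschitz for
   it. *)
pose dist x y := \sum_(p <- F) \sum_(i < ct_m p.2) `|ct_g p.2 i x - ct_g p.2 i y|.
have c1 : continuous (fun _ : K => 1 : R) by move=> x; exact: cvg_cst.
have L1 : 0 <= L (fun=> 1) by apply: (pfun_ge0 HL).
have distc y : continuous (dist ^~ y).
  rewrite /dist; elim: (F) (fun p pF => (HF p pF).1) => [|p s IH] H.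
    by under eq_fun do rewrite big_nil; move=> x; exact: cvg_cst.
  under eq_fun do rewrite big_cons.
  move=> x; apply: cvgD; last by apply: IH => q qs; apply: H; right.
  apply: cvg_big => [|i _]; first exact: add_continuous.
  apply: cvg_norm; apply: cvgB; last exact: cvg_cst.
  by apply: Dc; apply: H; left.
have dist0 x : dist x x = 0.
  by apply: big1 => p _; apply: big1 => i _; rewrite subrr normr0.
have [nu Hnu] := positive_functional_approx cK L dist (d / (L (fun=> 1) + 1))
  HL distc dist0 (divr_gt0 d0 (ltr_wpDl L1 ltr01)).
have := Hd (pair nu); rewrite ltr_distl => /(_ _)/andP[].
  move=> p i pF; apply: (@le_lt_trans _ _ (d / (L (fun=> 1) + 1) * L (fun=> 1))).
    apply: Hnu => [|x y]; first by apply: Dc; case: (HF p pF).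
    apply: le_trans (ler_bigsum_In _ _ (fun p => \sum_(i < ct_m p.2)
      `|ct_g p.2 i x - ct_g p.2 i y|) p (fun _ => sumr_ge0 _ _) pF) => //.
    by rewrite (bigD1 i)//= lerDl sumr_ge0.
  by rewrite mulrAC ltr_pdivrMr ?ltr_wpDl// ltr_pM2l// ltrDl.
by have := HM nu; rewrite /cyl_val; lra.
Qed.

End MaximumPrinciple.

(** * The orbit curve through the maximizer *)

Theorem theorem3p4 (R : realType) (K : pseudoPMetricType R)
  (HK : hausdorff_space K) (cK : compact [set: K])
  (D : set (K -> R)) (HD : dense_subspace_one D)
  (F : cyl_formula R K) (HF : in_calD D F)
  (nus : {finite_measure set (borelK K) -> \bar R})
  (Hmax : forall nu : {finite_measure set (borelK K) -> \bar R},
      cyl_val F nu <= cyl_val F nus)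
  (T : R -> (K -> R) -> (K -> R)) (HT : pos_C0_group T)
  (A : (K -> R) -> (K -> R)) (HA : is_generator T A)
  (HDA : forall g, D g -> gen_dom T g /\ gen_dom T (A g)) :
  forall mu : {finite_measure set (borelK K) -> \bar R},
    (forall S : set (borelK K), measurable S -> (mu S <= nus S)%E) ->
    msupp mu `<=` msupp nus ->
    (* (A (x) A)(d^2 f(nus)) computed from any representation
       d^2 f(nus) = \sum_i c_i g_i (x) g_i  with g_i in D *)
    forall (n : nat) (c : 'I_n -> R) (gs : 'I_n -> K -> R),
      (forall i, D (gs i)) ->
      (forall x y, d2cyl F nus x y = \sum_(i < n) c i * (gs i x * gs i y)) ->
      pair mu (A (A (dcyl F nus)))
      + pair2 mu (fun x y => \sum_(i < n) c i * (A (gs i) x * A (gs i) y))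
      <= 0.
Proof.
move=> mu munu _ n c gs Dgs Hd2.
case: (HD) => Dc Dadd Dscale D1 _.
have Dlin a b g h : D g -> D h -> D (fun x => a * g x + b * h x).
  by move=> Dg Dh; apply: Dadd; exact: Dscale.
have T0 : forall g, continuous g -> T 0 g = g by case: HT.
have Ac g : D g -> continuous (A g) by move=> /HDA[/HA[]].
have AAc g : D g -> continuous (A (A g)) by move=> /HDA[_ /HA[]].
have Pmu := pair_positive cK mu.
have Alin a b g h : D g -> D h ->
    A (fun x => a * g x + b * h x) = (fun x => a * A g x + b * A h x).
  move=> Dg Dh; apply: (generator_lin HT HA).
  - exact: (HDA g Dg).1.
  - exact: (HDA h Dh).1.
  - exact: (HDA _ (Dlin a b g h Dg Dh)).1.
have AAlin a b g h : D g -> D h ->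
    A (A (fun x => a * g x + b * h x)) =
    (fun x => a * A (A g) x + b * A (A h) x).
  move=> Dg Dh; rewrite Alin//; apply: (generator_lin HT HA).
  - exact: (HDA g Dg).2.
  - exact: (HDA h Dh).2.
  - by rewrite -Alin//; exact: (HDA _ (Dlin a b g h Dg Dh)).2.
(* [T 0] is kept so that these are literally the velocity and acceleration of the curve at 0;
   [T 0 g = g] is known for continuous [g] only. *)
pose ell1 g := pair mu (T 0 (A g)).
pose ell2 g := pair mu (T 0 (A (A g))).
have P0 := pfun_group HT 0 _ Pmu.
have ell1_lin a b g h : D g -> D h ->
    ell1 (fun x => a * g x + b * h x) = a * ell1 g + b * ell1 h.
  by move=> Dg Dh; rewrite /ell1 Alin// (pfun_lin P0)//; exact: Ac.
have ell2_lin a b g h : D g -> D h ->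
    ell2 (fun x => a * g x + b * h x) = a * ell2 g + b * ell2 h.
  by move=> Dg Dh; rewrite /ell2 AAlin// (pfun_lin P0)//; exact: AAc.
(* Subtracting [pair mu (T 0 g)] rather than [pair mu g] makes
   [curve 0 = pair nus] hold on all functions, continuous or not. *)
pose curve t g := pair nus g + (pair mu (T t g) - pair mu (T 0 g)).
have curve0 : curve 0 = pair nus.
  by apply/funext => g; rewrite /curve subrr addr0.
have curve_pos t : positive_functional (curve t).
  have Pt := pfun_group HT t _ Pmu; have Pn := pair_positive cK nus.
  split=> [a b g h cg ch|g cg g0].
    by rewrite /curve (pfun_lin Pt)// (pfun_lin P0)// (pfun_lin Pn)//; ring.
  (* Regrouped as the pairing of [T t g] with [mu], plus the pairing of [g] with [nus] minus that
     with [mu], nonnegative by domination. *)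
  rewrite /curve addrCA; apply: addr_ge0; first exact: (pfun_ge0 Pt).
  by rewrite T0// subr_ge0; apply: pair_le.
have curve_max t : cyl_eval F (curve t) <= cyl_eval F (curve 0).
  rewrite curve0; exact: (cyl_eval_le_max cK HF Dc).
have curve_der g (t : R) : D g ->
    is_derive t 1 (fun s => curve s g) (pair mu (T t (A g))).
  move=> Dg; case: (HDA g Dg) => -[cg _] _.
  have [cAg qg] := HA g (HDA g Dg).1.
  have H1 := is_derive_orbit HT Pmu g (A g) t cg cAg qg.
  have := is_deriveD (is_derive_cst (pair nus g) t 1)
    (is_deriveD H1 (is_derive_cst (- pair mu (T 0 g)) t 1)).
  by move=> /is_derive_eq; apply; rewrite add0r addr0.
have dcurve_der g (t : R) : D g ->
    is_derive t 1 (fun s => pair mu (T s (A g))) (pair mu (T t (A (A g)))).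
  move=> Dg; case: (HDA g Dg) => _ gA; have [cAAg qAg] := HA _ gA.
  by apply: (is_derive_orbit HT Pmu) => //; exact: Ac.
have H1 (t : R) : is_derive t 1 (fun s => cyl_eval F (curve s))
    (cyl_d1 F (curve t) (fun g => pair mu (T t (A g)))).
  by apply: (is_derive_cyl_eval HF) => g Dg; exact: curve_der.
have := is_derive_cyl_d1 HF (fun g Dg => curve_der g 0 Dg) _ _
  (fun g Dg => dcurve_der g 0 Dg).
move=> /(max_second_derivative_le0 _ _ _ curve_max H1).
rewrite curve0 addrC -/ell1 -/ell2.
have d1E : dcyl F nus = (fun x => cyl_d1 F (pair nus) (fun g => g x)).
  by apply/funext => x; exact: (dcylE HF).
(* The acceleration term is [ell2] of the first derivative of f, which lies in [D]. *)
have [Dd <-] := cyl_d1_lin D1 Dlin ell2_lin HF (pair nus).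
rewrite -d1E /ell2 T0; last by apply: AAc; rewrite d1E.
congr (_ + _ <= 0).
have Hd2' x y : cyl_d2 F (pair nus) (fun g => g y) (fun g => g x) =
    \sum_(i < n) c i * (gs i x * gs i y).
  by rewrite -Hd2; exact/esym/(d2cylE HF).
rewrite (cyl_d2_representation D1 Dlin ell1_lin HF (pair nus) n c gs Dgs Hd2').
have cA i : continuous (A (gs i)) by exact/Ac/Dgs.
have E1 i : ell1 (gs i) = pair mu (A (gs i)) by rewrite /ell1 T0.
(* For fixed [y] the kernel is a finite combination of the [A (gs i)], so the iterated integral
   splits into products of single pairings. *)
rewrite /pair2.
have -> : (fun y : borelK K => Rintegral mu setT
     (fun x => \sum_(i < n) c i * (A (gs i) x * A (gs i) y))) =
   (fun y => \sum_(i < n) (c i * ell1 (gs i)) * A (gs i) y).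
  apply/funext => y.
  transitivity (pair mu (fun x => \sum_(i < n) (c i * A (gs i) y) * A (gs i) x)).
    by congr (pair mu _); apply/funext => x; apply: eq_bigr => i _; ring.
  rewrite (pfun_sum Pmu n (fun i => c i * A (gs i) y) _ cA).2.
  by apply: eq_bigr => i _; rewrite E1; ring.
rewrite -/(pair mu _) (pfun_sum Pmu n (fun i => c i * ell1 (gs i)) _ cA).2.
by apply: eq_bigr => i _; rewrite E1; ring.
Qed.
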